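(* Let $K\subset\mathbb{R}^n$ be a convex body with non-empty interior. Then $$\left(8^{n/2}\,\mathrm{vol}(K)\right)^{1/2}\leq\mathcal{W}(K)\leq\frac{8^{n/2}\,\mathrm{vol}(K)}{\sup_{y\in\mathbb{R}^n}\gamma_n\bigl(y+\sqrt{2\pi}\,K\bigr)},$$ where $\mathcal{W}$ is the Wills functional and $\gamma_n$ is the standard Gaussian probability measure on $\mathbb{R}^n$.
   Context: A convex body in $\mathbb{R}^n$ is a non-empty compact convex set; $\mathrm{vol}$ is $n$-dimensional Lebesgue measure. With $B_2^n$ the Euclidean unit ball and $\kappa_j=\mathrm{vol}_j(B_2^j)=\pi^{j/2}/\Gamma(j/2+1)$, the intrinsic volumes $\mathrm{V}_i(K)$, $0\le i\le n$, of a convex body $K$ are defined by the Steiner formula $\mathrm{vol}(K+\lambda B_2^n)=\sum_{i=0}^n\kappa_{n-i}\mathrm{V}_i(K)\lambda^{n-i}$ for all $\lambda\geq 0$. The Wills functional is $\mathcal{W}(K)=\sum_{i=0}^n\mathrm{V}_i(K)$; equivalently, $\mathcal{W}(K)=\int_{\mathbb{R}^n}e^{-\pi d(x,K)^2}\,dx$, where $d(x,K)$ is the Euclidean distance from $x$ to $K$. The measure $\gamma_n$ is given by $d\gamma_n(x)=(2\pi)^{-n/2}e^{-|x|^2/2}\,dx$. *)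

(* Defs.v *)
From HB Require Import structures.
From mathcomp Require Import all_boot all_order all_algebra.
From mathcomp Require Import all_classical all_reals all_analysis.

Set Implicit Arguments.
Unset Strict Implicit.
Unset Printing Implicit Defensive.

Import Order.TTheory GRing.Theory Num.Theory.
Import numFieldNormedType.Exports.

Local Open Scope classical_set_scope.
Local Open Scope ring_scope.

(* The Borel sigma-algebra of R^n, in the form of the sigma-algebra generated
   by the n coordinate projections. *)

Definition rV_display : measure_display.
Proof. exact: default_measure_display. Qed.

Section measurable_rV.
Context {R : realType} {n : nat}.

Let coor (i : 'I_n) (x : 'rV[R]_n) : measurableTypeR R := x ord0 i.

Let rV_set0 : g_sigma_preimage coor set0.
Proof. exact: sigma_algebra0. Qed.

Let rV_setC A : g_sigma_preimage coor A -> g_sigma_preimage coor (~` A).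
Proof. exact: sigma_algebraC. Qed.

Let rV_bigcup (F : (set 'rV[R]_n)^nat) :
  (forall i, g_sigma_preimage coor (F i)) ->
  g_sigma_preimage coor (\bigcup_i (F i)).
Proof. exact: sigma_algebra_bigcup. Qed.

HB.instance Definition _ := @isMeasurable.Build rV_display 'rV[R]_n
  (g_sigma_preimage coor) rV_set0 rV_setC rV_bigcup.

Lemma measurable_coor (i : 'I_n) :
  measurable_fun [set: 'rV[R]_n] (fun x => x ord0 i : measurableTypeR R).
Proof.
move=> _ Y mY; rewrite setTI; apply: sub_sigma_algebra => /=.
rewrite -bigcup_seq/=; exists i => /=; first by rewrite mem_index_enum.
by exists Y => //; rewrite setTI.
Qed.

Lemma measurable_fun_rV d (T : measurableType d) (f : T -> 'rV[R]_n) :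
  (forall i, measurable_fun [set: T] (fun t => f t ord0 i : measurableTypeR R)) ->
  measurable_fun [set: T] f.
Proof.
move=> mf; apply: (@measurability _ _ _ _ _ _
  (\big[setU/set0]_(i < n) preimage_set_system setT (coor i) measurable)) => //.
move=> _ [B + <-]; rewrite -bigcup_seq => -[i _ [C mC <-]].
by rewrite setTI; exact: (mf i).
Qed.

End measurable_rV.

Section cons_rV.
Context {R : realType} {n : nat}.

Definition cons_rV (p : measurableTypeR R * 'rV[R]_n) : 'rV[R]_n.+1 :=
  \row_i if unlift ord0 i is Some j then p.2 ord0 j else p.1.

Definition uncons_rV (x : 'rV[R]_n.+1) : measurableTypeR R * 'rV[R]_n :=
  (x ord0 ord0, \row_i x ord0 (lift ord0 i)).

Lemma cons_rV0 p : cons_rV p ord0 ord0 = p.1.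
Proof. by rewrite mxE unlift_none. Qed.

Lemma cons_rVS p i : cons_rV p ord0 (lift ord0 i) = p.2 ord0 i.
Proof. by rewrite mxE liftK. Qed.

Lemma cons_rVK : cancel cons_rV uncons_rV.
Proof.
move=> [a v]; rewrite /uncons_rV cons_rV0; congr pair.
by apply/rowP => i; rewrite mxE cons_rVS.
Qed.

Lemma uncons_rVK : cancel uncons_rV cons_rV.
Proof.
move=> x; apply/rowP => i; have [j ->|->] := unliftP ord0 i.
- by rewrite cons_rVS mxE.
- by rewrite cons_rV0.
Qed.

Lemma measurable_cons_rV : measurable_fun [set: _] cons_rV.
Proof.
apply: measurable_fun_rV => i; have [j ->|->] := unliftP ord0 i.
- under eq_fun do rewrite cons_rVS.
  by apply: (measurableT_comp (measurable_coor j)).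
- apply: (eq_measurable_fun fst) => [p _|]; last exact: measurable_fst.
  by rewrite cons_rV0.
Qed.

Lemma measurable_uncons_rV : measurable_fun [set: _] uncons_rV.
Proof.
apply/measurable_fun_pair; first exact: measurable_coor.
apply: measurable_fun_rV => i /=.
by under eq_fun do rewrite mxE; exact: measurable_coor.
Qed.

End cons_rV.

Section cons_measure.
Context {R : realType} {n : nat}.
Variable mu : {sigma_finite_measure set 'rV[R]_n -> \bar R}.

Definition cons_measure : set 'rV[R]_n.+1 -> \bar R :=
  pushforward (@lebesgue_measure R \x mu)%E cons_rV.

Let measurable_preimage_cons (A : set 'rV[R]_n.+1) :
  measurable A -> measurable (cons_rV @^-1` A).
Proof.
by move=> mA; rewrite -[X in measurable X]setTI; exact: measurable_cons_rV.
Qed.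

Let cons_measure0 : cons_measure set0 = 0%E.
Proof. by rewrite /cons_measure /pushforward preimage_set0 measure0. Qed.

Let cons_measure_ge0 A : (0 <= cons_measure A)%E.
Proof. by rewrite /cons_measure /pushforward; exact: measure_ge0. Qed.

Let cons_measure_sigma_additive : semi_sigma_additive cons_measure.
Proof.
move=> F mF tF mUF; rewrite /cons_measure /pushforward preimage_bigcup.
apply: measure_semi_sigma_additive.
- by move=> k; exact: measurable_preimage_cons.
- apply/trivIsetP => /= i j _ _ ij; rewrite -preimage_setI.
  by move/trivIsetP : tF => /(_ _ _ _ _ ij) ->//; rewrite preimage_set0.
- by rewrite -preimage_bigcup; exact: measurable_preimage_cons.
Qed.

HB.instance Definition _ := isMeasure.Build _ _ _ cons_measure
  cons_measure0 cons_measure_ge0 cons_measure_sigma_additive.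

Let cons_measure_sigma_finite : sigma_finite setT cons_measure.
Proof.
have /sigma_finiteP[F [TF ndF Foo]] := sigma_finiteT (@lebesgue_measure R).
have /sigma_finiteP[G [TG ndG Goo]] := sigma_finiteT mu.
exists (fun k => uncons_rV @^-1` (F k `*` G k)).
  rewrite -preimage_bigcup predeqE => x; split=> // _.
  have [i _ Fi] : (\bigcup_k F k) (uncons_rV x).1 by rewrite -TF.
  have [j _ Gj] : (\bigcup_k G k) (uncons_rV x).2 by rewrite -TG.
  exists (maxn i j) => //; split.
  - by move: Fi; exact/subsetPset/ndF/leq_maxl.
  - by move: Gj; exact/subsetPset/ndG/leq_maxr.
move=> k; have [mF Fk] := Foo k; have [mG Gk] := Goo k; split.
  rewrite -[X in measurable X]setTI; apply: measurable_uncons_rV => //.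
  exact: measurableX.
rewrite /cons_measure /pushforward -comp_preimage.
rewrite (_ : uncons_rV \o cons_rV = id); last first.
  by apply/funext => p; exact: cons_rVK.
by rewrite preimage_id product_measure1E// lte_mul_pinfty// ge0_fin_numE.
Qed.

HB.instance Definition _ := Measure_isSigmaFinite.Build _ _ _ cons_measure
  cons_measure_sigma_finite.

End cons_measure.

(* n-dimensional Lebesgue measure, as the n-fold product of one-dimensional
   Lebesgue measure. *)
Fixpoint lebesgue_rV (R : realType) (n : nat) :
    {sigma_finite_measure set 'rV[R]_n -> \bar R} :=
  match n return {sigma_finite_measure set 'rV[R]_n -> \bar R} with
  | 0 => \d_(0 : 'rV[R]_0)
  | m.+1 => cons_measure (lebesgue_rV R m)
  end.

Lemma lebesgue_rV_box (R : realType) n (A : 'I_n -> set (measurableTypeR R)) :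
  (forall i, measurable (A i)) ->
  lebesgue_rV R n [set x | forall i, A i (x ord0 i)] =
  (\prod_(i < n) (@lebesgue_measure R (A i)))%E.
Proof.
elim: n A => [|n IH] A mA.
  rewrite big_ord0 /= diracE (_ : _ \in _ = true) //.
  by apply/mem_set => -[].
rewrite big_ord_recl -IH// /= /cons_measure /pushforward.
rewrite -product_measure1E//; last first.
  suff E : forall B : 'I_n -> set (measurableTypeR R),
    [set x : 'rV[R]_n | forall i, B i (x ord0 i)] = \bigcap_(i in [set: 'I_n])
      ((fun x : 'rV[R]_n => x ord0 i : measurableTypeR R) @^-1` B i).
    rewrite [X in measurable X](E (fun i => A (lift ord0 i))).
    apply: fin_bigcap_measurable => // i _.
    by rewrite -[X in measurable X]setTI; apply: measurable_coor.
  move=> B; apply/seteqP; split => [x h i _|x h i]; first exact: (h i).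
  exact: (h i I).
congr (_ _); apply/seteqP; split => [p h|p [h0 hS] i].
  split; first by have := h ord0; rewrite cons_rV0.
  by move=> i; have := h (lift ord0 i); rewrite cons_rVS.
have [j ->|->] := unliftP ord0 i; first by rewrite cons_rVS; exact: hS.
by rewrite cons_rV0.
Qed.

Section wills.
Context {R : realType}.

Definition sqnorm n (x : 'rV[R]_n) : R := \sum_(i < n) x ord0 i ^+ 2.

Definition enorm n (x : 'rV[R]_n) : R := Num.sqrt (sqnorm x).

Definition eball n : set 'rV[R]_n := [set x | enorm x <= 1].
Arguments eball n x : clear implicits.

Definition minkowski_sum n (A B : set 'rV[R]_n) : set 'rV[R]_n :=
  [set x + y | x in A & y in B].

Definition dilate n (a : R) (A : set 'rV[R]_n) : set 'rV[R]_n :=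
  [set a *: x | x in A].

Definition translate n (y : 'rV[R]_n) (A : set 'rV[R]_n) : set 'rV[R]_n :=
  [set y + x | x in A].

Definition convex_body n (K : set 'rV[R]_n) : Prop :=
  [/\ K !=set0, compact K & convex_set K].

Definition kappa (j : nat) : R := fine (lebesgue_rV R j (eball j)).

(* V lists the intrinsic volumes V_0(K), ..., V_n(K).  They are defined
   implicitly, as the coefficients in Steiner's formula; a real polynomial being
   determined by its values on [0, +oo[ and every kappa j being positive, at most
   one V qualifies for a given K, and Steiner's theorem says that one does when K
   is a convex body. *)
Definition intrinsic_volumes n (K : set 'rV[R]_n) (V : 'I_n.+1 -> R) : Prop :=
  forall lambda : R, 0 <= lambda ->
    lebesgue_rV R n (minkowski_sum K (dilate lambda (eball n))) =
    (\sum_(i < n.+1) kappa (n - i) * V i * lambda ^+ (n - i))%:E.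

Definition is_wills_functional n (K : set 'rV[R]_n) (w : R) : Prop :=
  exists2 V, intrinsic_volumes K V & w = \sum_(i < n.+1) V i.

Definition gamma n (A : set 'rV[R]_n) : \bar R :=
  (\int[lebesgue_rV R n]_(x in A)
    ((2 * pi) `^ (- (n%:R / 2)) * expR (- (enorm x ^+ 2 / 2)))%:E)%E.

End wills.

Arguments eball {R} n x.

(* Main.v *)
Require Import Defs.
From HB Require Import structures.
From mathcomp Require Import all_boot all_order all_algebra.
From mathcomp Require Import all_classical all_reals all_analysis.
From mathcomp Require Import measurable_realfun ring lra.

Set Implicit Arguments.
Unset Strict Implicit.
Unset Printing Implicit Defensive.

Import Order.TTheory GRing.Theory Num.Theory.
Import numFieldNormedType.Exports.

Local Open Scope classical_set_scope.
Local Open Scope ring_scope.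

(** By the layer-cake formula and Steiner's formula, the Wills functional is
    [W = \int exp (- pi * d(x, K)^2) dx]; the constants [kappa j] cancel because
    for [K] a point the same computation evaluates a Gaussian integral.

    Upper bound.  After rescaling, the Gaussian measure is
    [\int_(z in K) exp (- pi * |z + b|^2) dz].  If [p] is the point of [K]
    nearest to [x] and [z] is in [K], then [m = (p + z) / 2] is in [K] and
    [|x - p|^2 + |z + b|^2 >= |x - b - 2 m|^2 / 2].  Substituting [m] for [z]
    (factor [2^n]) and integrating first in [x] (factor [2^(n/2)]) leaves
    [vol K].

    Lower bound.  This is the Prekopa-Leindler inequality for the indicator of
    [sqrt 2 * K], the Gaussian [exp (- pi * |y|^2)] and
    [exp (- pi * d(sqrt 2 * z, K)^2)]. *)

(** * Integration on R^n *)

Lemma cons_rVD (R : realType) n (s t : R) (u v : 'rV[R]_n) :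
  cons_rV (s + t, u + v) = cons_rV (s, u) + cons_rV (t, v).
Proof.
apply/rowP => i; have [j ->|->] := unliftP ord0 i.
  by rewrite !mxE liftK !mxE.
by rewrite !mxE unlift_none.
Qed.

Lemma cons_rVZ (R : realType) n (a s : R) (u : 'rV[R]_n) :
  cons_rV (a * s, a *: u) = a *: cons_rV (s, u).
Proof.
apply/rowP => i; have [j ->|->] := unliftP ord0 i.
  by rewrite !mxE liftK !mxE.
by rewrite !mxE unlift_none.
Qed.

Lemma sqnorm_cons (R : realType) n (s : R) (u : 'rV[R]_n) :
  sqnorm (cons_rV (s, u)) = s ^+ 2 + sqnorm u.
Proof.
rewrite /sqnorm big_ord_recl cons_rV0; congr (_ + _).
by apply: eq_bigr => i _; rewrite cons_rVS.
Qed.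

Section tonelli_rV.
Context {R : realType}.
Local Open Scope ereal_scope.

Lemma integral_rV0 (f : 'rV[R]_0 -> \bar R) :
  (forall x, 0 <= f x) ->
  \int[lebesgue_rV R 0]_x f x = f (0 : 'rV[R]_0)%R.
Proof.
move=> f0; rewrite /= integral_dirac ?diracT ?mul1e//.
rewrite (_ : f = cst (f 0%R)) ?measurable_cst//.
by apply/funext => x /=; congr f; apply/rowP => -[].
Qed.

Lemma measurable_cons_fst n (t : R) :
  measurable_fun [set: 'rV[R]_n] (fun v => cons_rV (t : measurableTypeR R, v)).
Proof.
apply: (measurableT_comp measurable_cons_rV).
exact: measurable_pair1.
Qed.

Lemma measurable_fun_marginal n (f : 'rV[R]_n.+1 -> \bar R) :
  measurable_fun setT f -> (forall x, 0 <= f x) ->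
  measurable_fun setT (fun t : measurableTypeR R =>
    \int[lebesgue_rV R n]_v f (cons_rV (t, v))).
Proof.
move=> mf f0.
apply: (measurable_fun_fubini_tonelli_F (m2 := lebesgue_rV R n) (f \o cons_rV)).
  by apply: (measurableT_comp mf measurable_cons_rV).
by move=> x /=.
Qed.

Lemma integral_rVS n (f : 'rV[R]_n.+1 -> \bar R) :
  measurable_fun setT f -> (forall x, 0 <= f x) ->
  \int[lebesgue_rV R n.+1]_x f x =
  \int[@lebesgue_measure R]_t \int[lebesgue_rV R n]_v f (cons_rV (t, v)).
Proof.
move=> mf f0.
rewrite /= /cons_measure ge0_integral_pushforward//; last exact: measurable_cons_rV.
rewrite preimage_setT fubini_tonelli1//; last by move=> x /=.
exact: (measurableT_comp mf measurable_cons_rV).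
Qed.

Lemma measurable_affine1 (a b : R) :
  measurable_fun setT (fun t : measurableTypeR R => (a * t + b)%R : measurableTypeR R).
Proof. by apply: measurable_funD => //; apply: measurable_funM. Qed.

(** The push-forward of Lebesgue measure under [t |-> a * t + b], multiplied by [a], gives each
    half-open interval its length, hence is Lebesgue measure by uniqueness. *)
Lemma integral_affine1 (a b : R) (f : measurableTypeR R -> \bar R) :
  (0 < a)%R -> measurable_fun setT f -> (forall x, 0 <= f x) ->
  a%:E * \int[@lebesgue_measure R]_t f (a * t + b)%R =
  \int[@lebesgue_measure R]_t f t.
Proof.
move=> a0 mf f0.
pose phi (t : measurableTypeR R) : measurableTypeR R := (a * t + b)%R.
pose na : {nonneg R} := NngNum (ltW a0).
have mphi : measurable_fun setT phi := measurable_affine1 a b.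
pose m : {measure set (measurableTypeR R) -> \bar R} :=
  mscale na (measure_function_pushforward__canonical__measure_function_Measure
    (@lebesgue_measure R) mphi).
have -> : \int[@lebesgue_measure R]_t f t = \int[m]_t f t.
  apply: eq_measure_integral => A mA _.
  apply: (lebesgue_measure_unique (mu := m)) => //.
  move=> _ [[u v]] _ <- /=.
  rewrite /mscale /= /pushforward.
  rewrite (_ : phi @^-1` _ = `]((u - b) / a)%R, ((v - b) / a)%R]%classic); last first.
    apply/seteqP; split => t /=; rewrite !in_itv/= /phi ltr_pdivrMr// ler_pdivlMr//.
      by rewrite ltrBlDr lerBrDr (mulrC t).
    by rewrite ltrBlDr lerBrDr (mulrC t).
  rewrite !lebesgue_measure_itv/= !lte_fin ltr_pM2r ?invr_gt0// ltrD2r.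
  case: ifPn => _; last by rewrite mule0.
  by rewrite -!EFinB -EFinM; congr EFin; field; rewrite gt_eqF.
rewrite ge0_integral_mscale//=; congr (_ * _).
by rewrite ge0_integral_pushforward//= preimage_setT.
Qed.

Lemma measurable_affine n (a : R) (b : 'rV[R]_n) :
  measurable_fun setT (fun x : 'rV[R]_n => a *: x + b)%R.
Proof.
apply: measurable_fun_rV => i.
apply: (eq_measurable_fun (fun x : 'rV[R]_n =>
  a * (x ord0 i : measurableTypeR R) + b ord0 i)%R) => [x _|].
  by rewrite !mxE.
exact: (measurableT_comp (measurable_affine1 a (b ord0 i)) (measurable_coor i)).
Qed.

(** Induction on the dimension: one factor [a] comes from the first coordinate, the remaining
    [a ^+ n] from each slice. *)
Lemma integral_affine n (a : R) (b : 'rV[R]_n) (f : 'rV[R]_n -> \bar R) :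
  (0 < a)%R -> measurable_fun setT f -> (forall x, 0 <= f x) ->
  (a ^+ n)%:E * \int[lebesgue_rV R n]_x f (a *: x + b)%R =
  \int[lebesgue_rV R n]_x f x.
Proof.
move=> a0; elim: n b f => [|n IH] b f mf f0.
  rewrite expr0 mul1e !integral_rV0//; congr f; by apply/rowP => -[].
have mfa : measurable_fun setT (fun x : 'rV[R]_n.+1 => f (a *: x + b)%R).
  exact: (measurableT_comp mf (measurable_affine a b)).
rewrite !integral_rVS//.
pose F (t : measurableTypeR R) := \int[lebesgue_rV R n]_v f (cons_rV (t, v)).
have F0 t : 0 <= F t by apply: integral_ge0.
have [b0 [bS ->]] : exists b0 bS, b = cons_rV (b0, bS).
  by exists (uncons_rV b).1, (uncons_rV b).2; rewrite -surjective_pairing uncons_rVK.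
rewrite -[RHS](integral_affine1 b0 a0 (measurable_fun_marginal mf f0) F0).
rewrite exprS EFinM -muleA; congr (_ * _).
rewrite -ge0_integralZl ?lee_fin ?exprn_ge0 ?ltW//; first last.
- by move=> t _; exact: integral_ge0.
- apply: (measurable_fun_marginal (f := fun x => f (a *: x + cons_rV (b0, bS))%R)) => //.
  exact: (measurableT_comp mf (measurable_affine a _)).
apply: eq_integral => t _; rewrite -[RHS](IH bS)//; last first.
  exact: (measurableT_comp mf (measurable_cons_fst _)).
by congr (_ * _); apply: eq_integral => v _; rewrite cons_rVD cons_rVZ.
Qed.

Lemma integral_shift n (b : 'rV[R]_n) (f : 'rV[R]_n -> \bar R) :
  measurable_fun setT f -> (forall x, 0 <= f x) ->
  \int[lebesgue_rV R n]_x f (x + b)%R = \int[lebesgue_rV R n]_x f x.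
Proof.
move=> mf f0; rewrite -[RHS](@integral_affine _ 1%R b)// expr1n mul1e.
by apply: eq_integral => x _; rewrite scale1r.
Qed.

End tonelli_rV.

Lemma measurable_sqnorm (R : realType) n : measurable_fun setT (@sqnorm R n).
Proof.
by apply: measurable_sum => i; apply: measurable_funX; exact: measurable_coor.
Qed.

(** * Gaussian integrals *)

Section gauss_rV.
Context {R : realType}.
Local Open Scope ereal_scope.

Lemma measurable_expsq n (c : R) :
  measurable_fun [set: 'rV[R]_n] (fun x => (expR (c * sqnorm x))%:E).
Proof.
apply/measurable_EFinP; apply: measurableT_comp => //.
by apply: measurable_funM => //; exact: measurable_sqnorm.
Qed.

(** The substitution by [Num.sqrt pi] turns [exp (- t^2)], of integral [Num.sqrt pi], into this
    integrand. *)
Lemma integral_gauss1 :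
  \int[@lebesgue_measure R]_t (expR (- pi * t ^+ 2))%:E = 1.
Proof.
have s0 : (0 < Num.sqrt pi :> R)%R by rewrite sqrtr_gt0 pi_gt0.
have := @integral_affine1 R (Num.sqrt pi) 0 (fun t => (gauss_fun t)%:E) s0.
rewrite integralT_gauss => /(_ _ _)/wrap[].
- by apply/measurable_EFinP; exact: measurable_gauss_fun.
- by move=> x; rewrite lee_fin gauss_fun_ge0.
move=> /(congr1 (fun x => (Num.sqrt pi)^-1%:E * x)).
rewrite /= muleA -EFinM mulVf ?gt_eqF// mul1e => <-.
apply: eq_integral => t _; rewrite /gauss_fun addr0 exprMn sqr_sqrtr ?pi_ge0//.
by rewrite mulNr.
Qed.

Lemma integral_gauss n :
  \int[lebesgue_rV R n]_x (expR (- pi * sqnorm x))%:E = 1.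
Proof.
elim: n => [|n IH].
  by rewrite integral_rV0 /sqnorm ?big_ord0 ?mulr0 ?expR0// => x; rewrite lee_fin expR_ge0.
rewrite integral_rVS; [|exact: measurable_expsq|by move=> x; rewrite lee_fin expR_ge0].
rewrite -integral_gauss1; apply: eq_integral => t _.
under eq_integral do rewrite sqnorm_cons mulrDr expRD EFinM.
rewrite ge0_integralZl ?IH ?mule1 ?lee_fin ?expR_ge0//; first exact: measurable_expsq.
Qed.

End gauss_rV.

(** * The Prekopa-Leindler inequality *)

Section layer_cake.
Context d (T : measurableType d) (R : realType).
Variable mu : {sigma_finite_measure set T -> \bar R}.
Variable f : T -> \bar R.
Hypotheses (mf : measurable_fun setT f) (f0 : forall x, (0 <= f x)%E).
Local Open Scope ereal_scope.

Let hypograph : set (T * measurableTypeR R) := [set p | (p.2)%:E <= f p.1].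

Let measurable_hypograph : measurable hypograph.
Proof.
rewrite -[X in measurable X]setTI; apply: measurable_lee => //.
  by apply/measurable_EFinP; exact: measurable_snd.
exact: (measurableT_comp mf measurable_fst).
Qed.

Lemma measurable_superlevel (t : R) : measurable [set x | t%:E <= f x].
Proof. by rewrite -[X in measurable X]setTI; exact: measurable_lee. Qed.

(** Superlevel sets are sections of the hypograph, and the measure of a section depends measurably
    on the height. *)
Lemma measurable_measure_superlevel :
  measurable_fun setT (fun t : measurableTypeR R => mu [set x | t%:E <= f x]).
Proof.
rewrite (_ : (fun _ => _) = mu \o ysection hypograph).
  exact: measurable_fun_ysection.
apply/funext => t /=; congr (mu _); apply/seteqP.
by split => x; rewrite /ysection /= inE.
Qed.

(** Tonelli for the indicator of the part of the hypograph at heights in []0, 1[]: a section over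
    [x] has length [mine (f x) 1], a section at height [t] is a superlevel set. The cap at 1 suits
    Gaussians and normalized functions, which never exceed 1. *)
Lemma layer_cake :
  \int[mu]_x mine (f x) 1 =
  \int[@lebesgue_measure R]_(t in `]0%R, 1%R[) mu [set x | t%:E <= f x].
Proof.
pose D : set (T * measurableTypeR R) := hypograph `&` (setT `*` `]0%R, 1%R[).
have mD : measurable D.
  by apply: measurableI => //; exact: measurableX.
have mF : measurable_fun setT (fun p => (\1_D p)%:E : \bar R).
  by apply/measurable_EFinP; exact: measurable_indic.
have F0 p : 0 <= (\1_D p)%:E :> \bar R by rewrite lee_fin.
have := fubini_tonelli (m1 := mu) (m2 := @lebesgue_measure R) _ mF F0.
have -> : \int[mu]_x \int[@lebesgue_measure R]_t (\1_D (x, t))%:E =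
    \int[mu]_x mine (f x) 1.
  apply: eq_integral => x _.
  have -> : \int[@lebesgue_measure R]_t (\1_D (x, t))%:E =
      lebesgue_measure [set t : measurableTypeR R | t%:E <= f x /\ (0 < t < 1)%R].
    rewrite -[RHS]mul1e -[RHS]integral_cst//; last first.
      rewrite [X in measurable X](_ : _ = xsection D x).
        exact: measurable_xsection.
      apply/seteqP; split => t; rewrite /xsection /= inE /D /= /hypograph /= in_itv/=.
        by move=> [].
      by move=> [? []].
    rewrite [RHS]integral_mkcond; apply: eq_integral => t _.
    rewrite /patch /= indicE; case: ifPn => [|/negP] tD; last first.
      by rewrite memNset// => -[? [_ /=]]; rewrite in_itv/= => ?; apply: tD; rewrite inE.
    by rewrite mem_set//; move: tD; rewrite inE /= /D /= /hypograph /= in_itv/= => -[].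
  (* The section over [x] is []0, f x]] when [f x < 1], and all of []0, 1[] otherwise. *)
  have [fx1|fx1] := ltP (f x) 1.
    have /fineK fxE : f x \is a fin_num.
      by rewrite fin_numE gt_eqF ?(lt_le_trans _ (f0 x))//= lt_eqF// (lt_trans fx1) ?ltry.
    rewrite (_ : mkset _ = `]0%R, fine (f x)]%classic).
      rewrite lebesgue_measure_itv/= lte_fin sube0 fxE.
      by case: ifPn => //; rewrite -leNgt -lee_fin fxE => f0'; apply/eqP; rewrite eq_le f0 f0'.
    apply/seteqP; split => t /=; rewrite in_itv/=.
      by move=> [+ /andP[-> _]]; rewrite -lee_fin fxE.
    move=> /andP[-> tf]; split; first by rewrite -fxE lee_fin.
    by rewrite (le_lt_trans tf)// -lte_fin fxE.
  rewrite (_ : mkset _ = `]0%R, 1%R[%classic).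
    by rewrite lebesgue_measure_itv/= lte_fin ltr01 sube0.
  apply/seteqP; split => t /=; rewrite in_itv/=; first by move=> [].
  by move=> /andP[t0 t1]; split; rewrite ?t0// (le_trans _ fx1)// lee_fin ltW.
move=> ->; rewrite [RHS]integral_mkcond; apply: eq_integral => t _.
rewrite /patch; case: ifPn => [|/negP] tD.
  rewrite -[RHS]mul1e -integral_cst//; last exact: measurable_superlevel.
  rewrite [RHS]integral_mkcond; apply: eq_integral => x _.
  rewrite /patch /= indicE; case: ifPn => [|/negP] xt.
    by rewrite mem_set//; split=> /=; move: xt tD; rewrite /hypograph !inE.
  by rewrite memNset// => -[? _]; apply: xt; rewrite inE.
rewrite integral0_eq// => x _; rewrite indicE memNset// => -[_ [_ /= xt]].
by apply: tD; rewrite inE.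
Qed.
End layer_cake.

(** * The Brunn-Minkowski inequality on the line *)

Section brunn_minkowski1.
Context {R : realType}.
Implicit Types A B C : set (measurableTypeR R).
Local Open Scope ereal_scope.

Lemma measurable_preimage_affine1 (a b : R) A :
  measurable A -> measurable [set t : measurableTypeR R | A (a * t + b)%R].
Proof.
by move=> mA; rewrite -[X in measurable X]setTI; apply: measurable_affine1.
Qed.

Lemma lebesgue_preimage_affine1 (a b : R) A :
  (0 < a)%R -> measurable A ->
  a%:E * @lebesgue_measure R [set t | A (a * t + b)%R] = lebesgue_measure A.
Proof.
move=> a0 mA.
rewrite -[RHS]mul1e -[RHS]integral_cst// [RHS]integral_mkcond.
have mAI := measurable_preimage_affine1 a b mA.
rewrite -[X in _ * X]mul1e -[X in _ * X]integral_cst// [X in _ * X]integral_mkcond.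
rewrite -[RHS](integral_affine1 b a0); last 2 first.
- by apply/(measurable_restrictT _ mA); exact: measurable_cst.
- by move=> x; rewrite /patch; case: ifP.
by congr (_ * _); apply: eq_integral.
Qed.

(* With [a] close to [sup A] and [b] close to [inf B], the sets [(A + b) / 2] and
   [(a + B) / 2] lie in [C] and overlap in a short interval at most. *)
Lemma brunn_minkowski1 A B C (M : R) :
  measurable A -> measurable B -> measurable C -> A !=set0 -> B !=set0 ->
  (forall x, A x -> x <= M)%R -> (forall x, B x -> - M <= x)%R ->
  (forall x y, A x -> B y -> C ((x + y) / 2)%R) ->
  lebesgue_measure A + lebesgue_measure B <= 2%:E * lebesgue_measure C.
Proof.
move=> mA mB mC A0 B0 AM BM ABC.
have hsA : has_sup A by split => //; exists M => x /AM.
have hiB : has_inf B by split => //; exists (- M)%R => x /BM.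
apply/lee_addgt0Pr => e e0.
have e4 : (0 < e / 4)%R by rewrite divr_gt0.
have [a Aa aA] := sup_adherent e4 hsA.
have [b Bb bB] := inf_adherent e4 hiB.
(* [A1] is [(A + b) / 2] and [B1] is [(a + B) / 2], written as preimages. *)
pose A1 := [set t : measurableTypeR R | A (2 * t + - b)%R].
pose B1 := [set t : measurableTypeR R | B (2 * t + - a)%R].
have mA1 : measurable A1 := measurable_preimage_affine1 _ _ mA.
have mB1 : measurable B1 := measurable_preimage_affine1 _ _ mB.
have two0 : (0 < 2 :> R)%R by [].
rewrite -(lebesgue_preimage_affine1 (- b) two0 mA) -/A1.
rewrite -(lebesgue_preimage_affine1 (- a) two0 mB) -/B1.
pose c := ((a + b) / 2)%R.
pose I : set (measurableTypeR R) := `[(c - e / 4)%R, (c + e / 4)%R]%classic.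
have mI : measurable I by exact: measurable_itv.
have mAB : measurable (A1 `\` B1) by exact: measurableD.
(* A common point [t] has [2 t - b <= sup A < a + e / 4] and [2 t - a >= inf B > b - e / 4], so it
   lies within [e / 8] of [c]. *)
have AI : A1 `<=` (A1 `\` B1) `|` I.
  move=> t At; have [Bt|] := pselect (B1 t); last by left.
  right; rewrite /I /= in_itv/= /c.
  have := sup_upper_bound hsA At; have := inf_lbound hiB.2 Bt.
  by move=> /= h1 h2; apply/andP; split; lra.
(* After division by 2 the allowed error is [e / 2], the length of [I]. *)
have -> : e%:E = 2%:E * (e / 2)%:E by rewrite -EFinM; congr EFin; field.
rewrite -!muleDr ?ge0_adde_def ?inE ?lee_fin ?divr_ge0 ?(ltW e0)//.
rewrite lee_pmul2l//.
have ABC1 : (A1 `\` B1) `|` B1 `<=` C.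
  move=> t [[At _]|Bt].
    by have := ABC _ _ At Bb; congr C; field.
  by have := ABC _ _ Aa Bt; congr C; field.
apply: (@le_trans _ _ (lebesgue_measure (A1 `\` B1) + lebesgue_measure I + lebesgue_measure B1)).
  rewrite leeD2r//; apply: le_trans (measureU2 _ _ _) => //.
  by apply: le_measure; rewrite ?inE//; exact: measurableU.
rewrite addeAC leeD//; last first.
  rewrite /I lebesgue_measure_itv/=; case: ifP => _; last by rewrite lee_fin; lra.
  by rewrite -EFinB lee_fin; lra.
rewrite -measureU//; last by rewrite setDE -setIA setICl setI0.
by apply: le_measure; rewrite ?inE//; exact: measurableU.
Qed.

End brunn_minkowski1.

(** * Prekopa-Leindler on the line for bounded functions *)

Section prekopa_leindler1.
Context {R : realType}.
Implicit Types f g h : measurableTypeR R -> \bar R.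
Local Open Scope ereal_scope.
Local Notation leb := (@lebesgue_measure R).

Lemma le_ereal_sqr (t : R) (y : \bar R) :
  (0 <= t)%R -> 0 <= y -> (t * t)%:E <= y * y -> t%:E <= y.
Proof.
move=> t0; case: y => [y| |]; [|by move=> *; exact: leey|by []].
by rewrite -EFinM !lee_fin => y0; rewrite -!expr2 ler_sqr.
Qed.

(* Normalizing the suprema of [f] and [g] to [1] makes their superlevel sets
   nonempty at the same heights, so that Brunn-Minkowski applies level by level. *)
Lemma prekopa_leindler1_normalized f g h (M : R) :
  measurable_fun setT f -> measurable_fun setT g -> measurable_fun setT h ->
  (forall x, 0 <= f x <= 1) -> (forall x, 0 <= g x <= 1) -> (forall x, 0 <= h x) ->
  (forall t : R, (0 < t < 1)%R -> exists x, t%:E <= f x) ->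
  (forall t : R, (0 < t < 1)%R -> exists x, t%:E <= g x) ->
  (forall x, f x != 0 -> (`|x| <= M)%R) -> (forall x, g x != 0 -> (`|x| <= M)%R) ->
  (forall x y, f x * g y <= h ((x + y) / 2)%R * h ((x + y) / 2)%R) ->
  \int[leb]_x f x + \int[leb]_x g x <= 2%:E * \int[leb]_x h x.
Proof.
move=> mf mg mh f01 g01 h0 f1 g1 fM gM fgh.
have f0 x : 0 <= f x by case/andP : (f01 x).
have g0 x : 0 <= g x by case/andP : (g01 x).
have mine1 k : (forall x, 0 <= k x <= 1) ->
    \int[leb]_x k x = \int[leb]_x mine (k x) 1.
  by move=> k01; apply: eq_integral => x _; rewrite min_l//; case/andP: (k01 x).
rewrite (mine1 _ f01) (mine1 _ g01) !layer_cake//.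
have msup (k : measurableTypeR R -> \bar R) : measurable_fun setT k ->
    (forall x, 0 <= k x) ->
    measurable_fun (`]0%R, 1%R[ : set (measurableTypeR R)) (fun t => leb [set x | t%:E <= k x]).
  by move=> mk k0; apply: measurable_funTS; exact: measurable_measure_superlevel.
rewrite -ge0_integralD//; [|exact: msup..].
apply: (@le_trans _ _ (\int[leb]_(t in `]0%R, 1%R[) (2%:E * leb [set x | t%:E <= h x]))).
  apply: ge0_le_integral => //.
  - by move=> t _; rewrite adde_ge0.
  - by apply: emeasurable_funD; exact: msup.
  - by apply: emeasurable_funM => //; exact: msup.
  move=> t /=; rewrite in_itv/= => t01; have /andP[t0 _] := t01.
  apply: (@brunn_minkowski1 _ _ _ _ M); try exact: measurable_superlevel.
  - exact: f1.
  - exact: g1.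
  - move=> x /= tx; apply: le_trans (ler_norm _) (fM _ _).
    by rewrite gt_eqF// (lt_le_trans _ tx).
  - move=> x /= tx; suff : (`|x| <= M)%R by rewrite ler_norml => /andP[].
    by apply: gM; rewrite gt_eqF// (lt_le_trans _ tx).
  (* At the midpoint [m], [t * t <= f x * g y <= h m * h m], hence [t <= h m]. *)
  move=> x y /= fx gy; apply: le_ereal_sqr => //; first exact: ltW.
  by rewrite EFinM; apply: le_trans (fgh _ _); apply: lee_pmul => //; rewrite lee_fin ltW.
rewrite ge0_integralZl//; last exact: msup.
(* [h] may exceed 1, but capping it only lowers its integral, which is the right direction. *)
rewrite lee_pmul2l// -layer_cake//; apply: ge0_le_integral => //.
- by move=> x _; rewrite le_min h0/=.
- by apply: measurable_mine.
- by move=> x _; rewrite ge_min lexx.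
Qed.

(** The number [a] is the supremum of [f], positive and finite here. After division by [a] the
    superlevel sets at all heights below 1 are nonempty. *)
Lemma ereal_sup_witness (T : Type) (f : T -> \bar R) (M : R) (x0 : T) :
  0 < f x0 -> (forall x, f x <= M%:E) ->
  exists a : R, [/\ (0 < a)%R, forall x, f x <= a%:E &
    forall t : R, (0 < t < 1)%R -> exists x, (t * a)%:E <= f x].
Proof.
move=> f0 fM; pose s := ereal_sup (range f).
have fs x : f x <= s by apply: ereal_sup_ubound; exists x.
have sM : s <= M%:E by apply: ge_ereal_sup => _ [x _ <-].
have s0 : 0 < s := lt_le_trans f0 (fs x0).
have sE : (fine s)%:E = s.
  by rewrite fineK// ge0_fin_numE ?(ltW s0)// (le_lt_trans sM)// ltry.
exists (fine s); split; first by rewrite -lte_fin sE.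
  by move=> x; rewrite sE.
move=> t /andP[t0 t1]; have : (t * fine s)%:E < s.
  by rewrite -sE lte_fin gtr_pMl// -lte_fin sE.
by move=> /ereal_sup_gt[_ [x _ <-]] /ltW; exists x.
Qed.

(** Dividing [f] and [g] by their suprema [a] and [b], and [h] by [Num.sqrt (a * b)], preserves the
    pointwise hypothesis. The normalized result gives a sum inequality [u + v <= 2 w], and the
    arithmetic-geometric mean inequality turns it into the product form [u v <= w^2]. *)
Lemma prekopa_leindler1_bounded f g h (M : R) :
  measurable_fun setT f -> measurable_fun setT g -> measurable_fun setT h ->
  (forall x, 0 <= f x <= M%:E) -> (forall x, 0 <= g x <= M%:E) ->
  (forall x, 0 <= h x) ->
  (forall x, f x != 0 -> (`|x| <= M)%R) -> (forall x, g x != 0 -> (`|x| <= M)%R) ->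
  (forall x y, f x * g y <= h ((x + y) / 2)%R * h ((x + y) / 2)%R) ->
  \int[leb]_x f x * \int[leb]_x g x <= \int[leb]_x h x * \int[leb]_x h x.
Proof.
move=> mf mg mh f01 g01 h0 fM gM fgh.
have f0 x : 0 <= f x by case/andP : (f01 x).
have g0 x : 0 <= g x by case/andP : (g01 x).
have H0 : 0 <= \int[leb]_x h x by exact: integral_ge0.
have [[x0 fx0]|/forallNP f_eq0] := pselect (exists x, 0 < f x); last first.
  have -> : \int[leb]_x f x = 0; last by rewrite mul0e mule_ge0.
  by apply: integral0_eq => x _; apply/eqP; rewrite eq_le f0 andbT leNgt; exact/negP.
have [[y0 gy0]|/forallNP g_eq0] := pselect (exists x, 0 < g x); last first.
  have -> : \int[leb]_x g x = 0; last by rewrite mule0 mule_ge0.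
  by apply: integral0_eq => x _; apply/eqP; rewrite eq_le g0 andbT leNgt; exact/negP.
have [|a [a0 fa ta]] := ereal_sup_witness (M := M) fx0.
  by move=> x; case/andP : (f01 x).
have [|b [b0 gb tb]] := ereal_sup_witness (M := M) gy0.
  by move=> x; case/andP : (g01 x).
pose c := Num.sqrt (a * b).
have c0 : (0 < c)%R by rewrite sqrtr_gt0 mulr_gt0.
have cE : (c * c = a * b)%R by rewrite -expr2 sqr_sqrtr// ltW// mulr_gt0.
have mZ (k : measurableTypeR R -> \bar R) (e : R) :
    measurable_fun setT k -> measurable_fun setT (fun x => e%:E * k x).
  by move=> mk; exact: measurable_funeM.
have Z0 (k : measurableTypeR R -> \bar R) (e : R) x :
    (0 < e)%R -> 0 <= k x -> 0 <= e^-1%:E * k x.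
  by move=> e0 k0; rewrite mule_ge0// lee_fin invr_ge0 ltW.
have Z1 (e : R) y : (0 < e)%R -> y <= e%:E -> e^-1%:E * y <= 1.
  by move=> e0 ye; rewrite muleC lee_pdivrMr// mul1e.
have Zt (k : measurableTypeR R -> \bar R) (e : R) :
    (0 < e)%R -> (forall t : R, (0 < t < 1)%R -> exists x, (t * e)%:E <= k x) ->
    (forall t : R, (0 < t < 1)%R -> exists x, t%:E <= e^-1%:E * k x).
  move=> e0 + t t01 => /(_ t t01)[x tx]; exists x.
  by rewrite muleC lee_pdivlMr.
have ZM (k : measurableTypeR R -> \bar R) (e : R) :
    (forall x, k x != 0 -> (`|x| <= M)%R) ->
    forall x, e^-1%:E * k x != 0 -> (`|x| <= M)%R.
  move=> kM x ekx; apply: kM; apply: contra ekx => /eqP ->.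
  by rewrite mule0.
have := @prekopa_leindler1_normalized (fun x => a^-1%:E * f x)
  (fun x => b^-1%:E * g x) (fun x => c^-1%:E * h x) M.
rewrite !ge0_integralZl ?lee_fin ?invr_ge0 ?(ltW a0) ?(ltW b0) ?(ltW c0)//.
move=> /(_ (mZ _ _ mf) (mZ _ _ mg) (mZ _ _ mh)) PL.
have {PL} := PL _ _ _ (Zt _ _ a0 ta) (Zt _ _ b0 tb) (ZM _ _ fM) (ZM _ _ gM).
move=> /(_ _ _ _ _)/wrap[].
- by move=> x; rewrite Z0//= Z1.
- by move=> x; rewrite Z0//= Z1.
- by move=> x; rewrite Z0.
- move=> x y; rewrite muleACA [leRHS]muleACA -!EFinM -!invfM cE.
  by rewrite lee_pmul2l// lte_fin invr_gt0 mulr_gt0.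
have F0 : 0 <= \int[leb]_x f x by exact: integral_ge0.
have G0 : 0 <= \int[leb]_x g x by exact: integral_ge0.
move: H0 F0 G0.
(* An infinite integral of [h] makes the claim trivial; a finite one excludes infinite integrals of
   [f] and [g] by the sum inequality. *)
case: (\int[leb]_x h x) => [H| |]//; last first.
  by move=> *; rewrite mulyy leey.
case: (\int[leb]_x f x) => [F| |]//; last first.
  move=> H0 _ G0; rewrite gt0_muley ?lte_fin ?invr_gt0// addye ?leye_eq//.
  by rewrite gt_eqF// (lt_le_trans ltNy0)// mule_ge0// lee_fin invr_ge0 ltW.
case: (\int[leb]_x g x) => [G| |]//; last first.
  by move=> H0 _ _; rewrite gt0_muley ?lte_fin ?invr_gt0// addey ?leye_eq.
rewrite -!EFinM -EFinD !lee_fin => H0 F0 G0 FGH.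
have -> : (F * G = a * b * ((a^-1 * F) * (b^-1 * G)))%R by field; rewrite !gt_eqF.
have -> : (H * H = a * b * ((c^-1 * H) * (c^-1 * H)))%R.
  by rewrite -cE; field; rewrite gt_eqF.
rewrite ler_pM2l ?mulr_gt0//.
move: FGH; set u := (a^-1 * F)%R; set v := (b^-1 * G)%R; set w := (c^-1 * H)%R.
have u0 : (0 <= u)%R by rewrite mulr_ge0// invr_ge0 ltW.
have v0 : (0 <= v)%R by rewrite mulr_ge0// invr_ge0 ltW.
move=> uvw.
(* [4 u v = (u + v)^2 - (u - v)^2 <= 4 w^2]. *)
have : ((u + v) * (u + v) <= (2 * w) * (2 * w))%R by rewrite ler_pM ?addr_ge0.
by have := sqr_ge0 (u - v)%R; clearbody u v w; rewrite expr2; lra.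
Qed.

End prekopa_leindler1.

(** * Removal of the bounds and induction on the dimension *)

Section prekopa_leindler.
Context {R : realType}.
Local Open Scope ereal_scope.
Local Notation leb := (@lebesgue_measure R).

(** Restricting to [[-k, k]] and capping at [k] gives an increasing sequence with limit [f];
    monotone convergence does the rest. *)
Lemma truncation_approx (f : measurableTypeR R -> \bar R) :
  measurable_fun setT f -> (forall x, 0 <= f x) ->
  exists f_ : nat -> measurableTypeR R -> \bar R,
    [/\ forall k, measurable_fun setT (f_ k),
        forall k x, 0 <= f_ k x <= k%:R%:E,
        forall k x, f_ k x != 0 -> (`|x| <= k%:R)%R,
        forall k x, f_ k x <= f x &
        \int[leb]_x f_ k x @[k --> \oo] --> \int[leb]_x f x].
Proof.
move=> mf f0.
pose f_ (k : nat) := (fun x => mine (f x) k%:R%:E) \_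
  (`[(- k%:R)%R, k%:R%R] : set (measurableTypeR R)).
have mf_ k : measurable_fun setT (f_ k).
  apply/(measurable_restrictT _ (measurable_itv `[_, _])); apply: measurable_funTS.
  by apply: measurable_mine => //; exact: measurable_cst.
have f_0 k x : 0 <= f_ k x.
  by rewrite /f_ /patch; case: ifP => _; [rewrite le_min f0 lee_fin ler0n|exact: lexx].
have f_in k x : (`|x| <= k%:R)%R -> f_ k x = mine (f x) k%:R%:E.
  by rewrite ler_norml => xk; rewrite /f_ /patch mem_set//= in_itv.
have f_out k x : ~~ (`|x| <= k%:R)%R -> f_ k x = 0.
  by rewrite ler_norml => xk; rewrite /f_ /patch memNset//= in_itv/=; exact/negP.
have f_le k x : f_ k x <= f x.
  have [/f_in ->|xk] := boolP (`|x| <= k%:R)%R; first by rewrite ge_min lexx.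
  by rewrite f_out.
have nd x : {homo f_ ^~ x : m n / (m <= n)%N >-> m <= n}.
  move=> m n mn; have [xm|xm] := boolP (`|x| <= m%:R)%R; last by rewrite (f_out _ _ xm).
  rewrite !f_in//; last by rewrite (le_trans xm)// ler_nat.
  by rewrite le_min !ge_min lexx/= lee_fin ler_nat mn orbT.
have f_cvg x : f_ k x @[k --> \oo] --> f x.
  have xk : \forall k \near \oo, (`|x| <= k%:R)%R by exact: nbhs_infty_ger.
  have := f0 x; case fx : (f x) => [r| |]// _.
    apply: cvg_near_cst; near=> k; rewrite f_in ?fx; last by near: k.
    by rewrite min_l// lee_fin; near: k; exact: nbhs_infty_ger.
  (* Where [f] is infinite, the truncation eventually equals its cap [k]. *)
  apply: cvg_trans (_ : (k%:R%:E : \bar R) @[k --> \oo] `=>` nbhs +oo).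
    apply: near_eq_cvg; near=> k; rewrite f_in ?fx; last by near: k.
    by rewrite min_r// leey.
  exact/cvgeryP/cvgr_idn.
exists f_; split => //.
- move=> k x; rewrite f_0/=; have [/f_in ->|xk] := boolP (`|x| <= k%:R)%R.
    by rewrite ge_min lexx orbT.
  by rewrite f_out.
- by move=> k x; apply: contraNT => /f_out ->.
rewrite (_ : \int[leb]_x f x = \int[leb]_x limn (f_ ^~ x)).
  by apply: cvg_monotone_convergence => //.
by apply: eq_integral => x _; apply/esym/cvg_lim => //; exact: f_cvg.
Unshelve. all: by end_near. Qed.

Lemma prekopa_leindler1 (f g h : measurableTypeR R -> \bar R) :
  measurable_fun setT f -> measurable_fun setT g -> measurable_fun setT h ->
  (forall x, 0 <= f x) -> (forall x, 0 <= g x) -> (forall x, 0 <= h x) ->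
  (forall x y, f x * g y <= h ((x + y) / 2)%R * h ((x + y) / 2)%R) ->
  \int[leb]_x f x * \int[leb]_x g x <= \int[leb]_x h x * \int[leb]_x h x.
Proof.
move=> mf mg mh f0 g0 h0 fgh.
have H0 : 0 <= \int[leb]_x h x by exact: integral_ge0.
have : 0 <= \int[leb]_x f x by exact: integral_ge0.
rewrite le_eqVlt => /predU1P[<-|F0]; first by rewrite mul0e mule_ge0.
have : 0 <= \int[leb]_x g x by exact: integral_ge0.
rewrite le_eqVlt => /predU1P[<-|G0]; first by rewrite mule0 mule_ge0.
have [f_ [mf_ f_b f_s f_f cvf]] := truncation_approx mf f0.
have [g_ [mg_ g_b g_s g_g cvg]] := truncation_approx mg g0.
(* With both integrals positive the product of the limits is not of the form [0 * +oo], so it is the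
   limit of the products. *)
have FG : \int[leb]_x f x *? \int[leb]_x g x.
  by rewrite mule_defE (gt_eqF F0) (gt_eqF G0).
apply: (cvge_le _ (cvgeM FG cvf cvg)); apply: nearW => k /=.
apply: (@prekopa_leindler1_bounded _ (f_ k) (g_ k) h k%:R
  (mf_ k) (mg_ k) mh (f_b k) (g_b k) h0 (f_s k) (g_s k)).
move=> x y; apply: le_trans (fgh x y).
by apply: lee_pmul => //; [case/andP: (f_b k x)|case/andP: (g_b k y)].
Qed.

(** Induction on the dimension: the induction hypothesis on slices says that the marginals in the
    first coordinate satisfy the one-dimensional hypothesis. This is the case of weights [1/2],
    squared so that no roots of extended reals occur. *)
Theorem prekopa_leindler n (f g h : 'rV[R]_n -> \bar R) :
  measurable_fun setT f -> measurable_fun setT g -> measurable_fun setT h ->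
  (forall x, 0 <= f x) -> (forall x, 0 <= g x) -> (forall x, 0 <= h x) ->
  (forall x y, f x * g y <= h (2^-1 *: (x + y))%R * h (2^-1 *: (x + y))%R) ->
  \int[lebesgue_rV R n]_x f x * \int[lebesgue_rV R n]_x g x <=
  \int[lebesgue_rV R n]_x h x * \int[lebesgue_rV R n]_x h x.
Proof.
elim: n f g h => [|n IH] f g h mf mg mh f0 g0 h0 fgh.
  rewrite !integral_rV0//; apply: le_trans (fgh _ _) _.
  by rewrite addr0 scaler0.
rewrite !integral_rVS//; apply: prekopa_leindler1;
  try exact: measurable_fun_marginal; try (by move=> t; exact: integral_ge0).
move=> s t; apply: IH => //; try exact: (measurableT_comp _ (measurable_cons_fst _)).
move=> x y; apply: le_trans (fgh _ _) _.
by rewrite -cons_rVD -cons_rVZ (mulrC (s + t)%R).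
Qed.

End prekopa_leindler.

(** * Distance to a compact set *)

Lemma measurable_box (R : realType) n (A : 'I_n -> set (measurableTypeR R)) :
  (forall i, measurable (A i)) ->
  measurable [set x : 'rV[R]_n | forall i, A i (x ord0 i)].
Proof.
move=> mA; rewrite (_ : mkset _ = \bigcap_(i in [set: 'I_n])
    ((fun x : 'rV[R]_n => x ord0 i : measurableTypeR R) @^-1` A i)).
  apply: fin_bigcap_measurable => // i _.
  by rewrite -[X in measurable X]setTI; exact: measurable_coor.
by apply/seteqP; split => [x h i _|x h i]; [exact: h|exact: (h i I)].
Qed.

Section topology_rV.
Context {R : realType} {n : nat}.
Implicit Types (A K U : set 'rV[R]_n) (x y : 'rV[R]_n).

(** The sigma-algebra comes from the coordinates, and an open set is the countable union of the
    rational open boxes that it contains. *)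
Lemma open_measurable_rV U : open U -> measurable U.
Proof.
move=> oU.
pose box (p : 'rV[rat]_n * 'rV[rat]_n) := [set x : 'rV[R]_n |
  forall i, ratr (p.1 ord0 i) < x ord0 i < ratr (p.2 ord0 i)].
have mbox p : measurable (box p).
  apply: (measurable_box (A := fun i =>
    [set t | ratr (p.1 ord0 i) < t < ratr (p.2 ord0 i)])) => i.
  by rewrite (_ : mkset _ = `]ratr (p.1 ord0 i), ratr (p.2 ord0 i)[%classic).
rewrite (_ : U = \bigcup_p (if `[< box p `<=` U >] then box p else set0)).
  apply: countable_bigcupT_measurable => [|p]; first exact: countableP.
  by case: ifP.
apply/seteqP; split => [x Ux|x [p _]]; last by case: asboolP => [pU /pU|_ []].
have /nbhs_ballP[e /= e0 xeU] : nbhs x U by exact: open_nbhs_nbhs.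
have lo i : exists q : rat, x ord0 i - e < ratr q < x ord0 i.
  have /rat_in_itvoo[q] : x ord0 i - e < x ord0 i by rewrite ltrBlDr ltrDl.
  by rewrite in_itv/=; exists q.
have hi i : exists q : rat, x ord0 i < ratr q < x ord0 i + e.
  have /rat_in_itvoo[q] : x ord0 i < x ord0 i + e by rewrite ltrDl.
  by rewrite in_itv/=; exists q.
have [a ax] := choice lo; have [b xb] := choice hi.
exists (\row_i a i, \row_i b i) => //.
have bU : box (\row_i a i, \row_i b i) `<=` U.
  move=> y yb; apply: xeU; split => //= j i; rewrite ord1 /ball/=.
  have := yb i; rewrite !mxE/= => /andP[ay yb'].
  have /andP[xa _] := ax i; have /andP[_ bx] := xb i.
  rewrite ltr_norml; apply/andP; split; first by rewrite ltrNl opprB ltrBlDl (lt_trans yb').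
  by rewrite ltrBlDl -ltrBlDr (lt_trans xa).
rewrite asboolT//= => i; rewrite !mxE.
by have /andP[_ ->] := ax i; have /andP[-> _] := xb i.
Qed.

Lemma closed_measurable_rV A : closed A -> measurable A.
Proof.
move=> cA; rewrite -[A]setCK; apply: measurableC; apply: open_measurable_rV; exact: closed_openC.
Qed.

Lemma compact_measurable_rV K : compact K -> measurable K.
Proof.
by move=> cK; apply: closed_measurable_rV; apply: compact_closed => //; exact: norm_hausdorff.
Qed.

Lemma continuous_sqnormB x : continuous (fun y : 'rV[R]_n => sqnorm (x - y)).
Proof.
apply: continuous_big => [|i _ y]; first exact: add_continuous.
rewrite (_ : (fun _ => _) = (fun t : R => (x ord0 i - t) ^+ 2) \o (fun y => y ord0 i)).
  apply: continuous_comp; first exact: coord_continuous.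
  apply: (@continuous_comp _ _ _ (fun t : R => x ord0 i - t) (fun t : R => t ^+ 2) _);
    last exact: exprn_continuous.
  by move=> t; apply: cvgB; [exact: cvg_cst|exact: cvg_id].
by apply/funext => z /=; rewrite !mxE.
Qed.

Lemma sqnorm_ge0 x : 0 <= sqnorm x.
Proof. by apply: sumr_ge0 => i _; exact: sqr_ge0. Qed.

Lemma sqnormZ (a : R) x : sqnorm (a *: x) = a ^+ 2 * sqnorm x.
Proof. by rewrite /sqnorm mulr_sumr; apply: eq_bigr => i _; rewrite mxE exprMn. Qed.

Lemma sqr_enorm x : enorm x ^+ 2 = sqnorm x.
Proof. by rewrite sqr_sqrtr// sqnorm_ge0. Qed.

Lemma sqnormN x : sqnorm (- x) = sqnorm x.
Proof. by rewrite -scaleN1r sqnormZ sqrrN expr1n mul1r. Qed.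

Lemma sqnorm_parallelogram x y :
  sqnorm (x + y) + sqnorm (x - y) = 2 * (sqnorm x + sqnorm y).
Proof.
rewrite /sqnorm -!big_split/= mulr_sumr; apply: eq_bigr => i _.
by rewrite !mxE; ring.
Qed.

Lemma eballP x : eball n x <-> sqnorm x <= 1.
Proof.
rewrite /eball/=; split => h.
  by rewrite -sqr_enorm expr_le1// sqrtr_ge0.
by rewrite -(ler_pXn2r (n := 2)) ?nnegrE ?sqrtr_ge0// expr1n sqr_enorm.
Qed.

Definition sqdist x K : R := inf [set sqnorm (x - k) | k in K].

Lemma sqdist_ge0 x K : K !=set0 -> 0 <= sqdist x K.
Proof.
move=> [k Kk]; apply: lb_le_inf; first by exists (sqnorm (x - k)), k.
by move=> _ [? _ <-]; exact: sqnorm_ge0.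
Qed.

Lemma sqdist_le x K k : K k -> sqdist x K <= sqnorm (x - k).
Proof.
move=> Kk; apply: inf_lbound; last by exists k.
by exists 0 => _ [? _ <-]; exact: sqnorm_ge0.
Qed.

Lemma sqdist_attained x K : K !=set0 -> compact K ->
  exists2 k, K k & sqdist x K = sqnorm (x - k).
Proof.
move=> K0 cK.
have [k /[!inE] Kk kmin] := @compact_EVT_min _ _ (fun k : 'rV[R]_n => sqnorm (x - k)) _ K0 cK
  (continuous_subspaceT (@continuous_sqnormB x)).
exists k => //; apply/eqP; rewrite eq_le sqdist_le//=.
apply: lb_le_inf; first by exists (sqnorm (x - k)), k.
by move=> _ [l Kl <-]; apply: kmin; rewrite inE.
Qed.

(** A strict sublevel set is a union of open balls centred in [K], hence open. *)
Lemma measurable_sqdist K : measurable_fun setT (sqdist ^~ K).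
Proof.
have [->|/set0P K0] := eqVneq K set0.
  apply: (eq_measurable_fun (cst (inf set0))) => // x _.
  by rewrite /sqdist image_set0.
apply: (measurability _ (RGenInftyO.measurableE R)) => // _ [_ [c ->] <-].
rewrite setTI (_ : _ @^-1` _ = \bigcup_(k in K) [set x | sqnorm (x - k) < c]).
  apply: open_measurable_rV; apply: bigcup_open => k _.
  rewrite (_ : mkset _ = (fun x => sqnorm (k - x)) @^-1` [set t | t < c]).
    by apply: open_comp; [move=> x _; exact: continuous_sqnormB|exact: open_lt].
  by apply/seteqP; split => x /=; rewrite -sqnormN opprB.
apply/seteqP; split => [x|x [k Kk /= xk]] /=; rewrite in_itv/=.
  move=> /inf_lt[|_ [k Kk <-] xk]; last by exists k.
  by case: K0 => k Kk; exists (sqnorm (x - k)), k.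
by rewrite (le_lt_trans (sqdist_le _ Kk)).
Qed.

(** Compactness provides a nearest point of [K]. This identifies the sublevel sets of the distance
    with the parallel bodies in Steiner's formula. *)
Lemma sqdist_sublevel K (r : R) : K !=set0 -> compact K -> 0 <= r ->
  [set x | sqdist x K <= r ^+ 2] = minkowski_sum K (dilate r (eball n)).
Proof.
move=> K0 cK r0; apply/seteqP; split => [x /= xr|_ [k Kk [_ [b /eballP b1 <-] <-]]] /=.
  have [k Kk xk] := sqdist_attained x K0 cK; rewrite xk in xr.
  exists k => //; exists (x - k); last by rewrite addrC subrK.
  (* A zero radius cannot be cancelled; there [x = k], and the zero vector is the witness in the
     ball. *)
  have [r_eq0|r_neq0] := eqVneq r 0.
    exists 0; first by apply/eballP; rewrite /sqnorm big1// => j _; rewrite mxE expr0n.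
    rewrite scaler0; apply/rowP => i; apply/eqP; rewrite eq_sym !mxE.
    move: xr; rewrite r_eq0 expr0n/= => xr.
    have : sqnorm (x - k) == 0 by rewrite eq_le xr sqnorm_ge0.
    rewrite psumr_eq0 => [|j _]; last exact: sqr_ge0.
    by move=> /allP/(_ i (mem_index_enum i))/=; rewrite sqrf_eq0 !mxE.
  exists (r^-1 *: (x - k)); last by rewrite scalerA divff// scale1r.
  apply/eballP; rewrite sqnormZ exprVn ler_pdivrMl ?mulr1//.
  by rewrite exprn_gt0// lt_def r_neq0.
apply: le_trans (sqdist_le _ Kk) _; rewrite addrC addKr sqnormZ.
by rewrite ler_piMr// sqr_ge0.
Qed.

End topology_rV.

(** * Wills functional and Gaussian measure *)

Section wills_integral.
Context {R : realType}.
Local Open Scope ereal_scope.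
Local Notation leb := (@lebesgue_measure R).

Lemma measurable_preimage_affine n (a : R) (b : 'rV[R]_n) (A : set 'rV[R]_n) :
  measurable A -> measurable [set x : 'rV[R]_n | A (a *: x + b)%R].
Proof.
by move=> mA; rewrite -[X in measurable X]setTI; apply: measurable_affine.
Qed.

Lemma lebesgue_preimage_affine n (a : R) (b : 'rV[R]_n) (A : set 'rV[R]_n) :
  (0 < a)%R -> measurable A ->
  (a ^+ n)%:E * lebesgue_rV R n [set x | A (a *: x + b)%R] = lebesgue_rV R n A.
Proof.
move=> a0 mA.
rewrite -[RHS]mul1e -[RHS]integral_cst// [RHS]integral_mkcond.
have mAI := measurable_preimage_affine a b mA.
rewrite -[X in _ * X]mul1e -[X in _ * X]integral_cst// [X in _ * X]integral_mkcond.
rewrite -[RHS](integral_affine b a0); last 2 first.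
- by apply/(measurable_restrictT _ mA); exact: measurable_cst.
- by move=> x; rewrite /patch; case: ifP.
by congr (_ * _); apply: eq_integral.
Qed.

(** The radius at which [exp (- pi * r^2)] falls to the height [t]. *)
Let rho (t : R) : R := Num.sqrt (- ln t / pi).

Let measurable_rho : measurable_fun (`]0%R, 1%R[ : set (measurableTypeR R)) rho.
Proof.
apply: (eq_measurable_fun (fun t : measurableTypeR R => (- ln t / pi) `^ 2^-1)%R).
  move=> t; rewrite inE /= in_itv/= => /andP[t0 t1]; rewrite powR12_sqrt//.
  by rewrite divr_ge0 ?pi_ge0// oppr_ge0 ln_le0// ltW.
apply: measurable_funTS; apply: (measurableT_comp (measurable_powR _)).
by apply: measurable_funM => //; apply: measurableT_comp => //; exact: measurable_ln.
Qed.

Let rho_gt0 t : (0 < t < 1)%R -> (0 < rho t)%R.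
Proof.
move=> /andP[t0 t1].
by rewrite sqrtr_gt0 divr_gt0 ?pi_gt0// oppr_gt0 ln_lt0// t0.
Qed.

Let superlevel_gauss t (s : R) : (0 < t < 1)%R ->
  (t%:E <= (expR (- pi * s))%:E) = (s <= rho t ^+ 2)%R.
Proof.
move=> /andP[t0 t1]; rewrite sqr_sqrtr; last first.
  by rewrite divr_ge0 ?pi_ge0// oppr_ge0 ln_le0// ltW.
rewrite lee_fin ler_pdivlMr ?pi_gt0// -[in LHS](lnK t0) ler_expR.
by rewrite mulNr lerNr (mulrC pi).
Qed.

Lemma lebesgue_eball n (r : R) : (0 < r)%R ->
  lebesgue_rV R n [set x | (sqnorm x <= r ^+ 2)%R] =
  (r ^+ n)%:E * lebesgue_rV R n (eball n).
Proof.
move=> r0.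
have msq : measurable [set x : 'rV[R]_n | (sqnorm x <= r ^+ 2)%R].
  have := @measurable_sqnorm R n measurableT _ (measurable_itv `]-oo, (r ^+ 2)%R]).
  by rewrite setTI; congr measurable; apply/seteqP; split => x /=; rewrite in_itv.
rewrite -(lebesgue_preimage_affine 0%R r0 msq); congr (_ * lebesgue_rV _ _ _).
apply/seteqP; split => x; rewrite eballP /= addr0 sqnormZ.
  by rewrite ger_pMr// exprn_gt0.
by rewrite ger_pMr// exprn_gt0.
Qed.

Let moment n := \int[leb]_(t in `]0%R, 1%R[) (rho t ^+ n)%:E.

Let measurable_rhoX n :
  measurable_fun (`]0%R, 1%R[ : set (measurableTypeR R)) (fun t => (rho t ^+ n)%:E).
Proof. by apply/measurable_EFinP; apply: measurable_funX. Qed.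

Let rhoX_ge0 n t : 0 <= (rho t ^+ n)%:E.
Proof. by rewrite lee_fin exprn_ge0// sqrtr_ge0. Qed.

(* Layer-cake for the Gaussian: stands in for an explicit formula for [kappa n]. *)
Let eball_moment n : lebesgue_rV R n (eball n) * moment n = 1.
Proof.
rewrite -(integral_gauss (R := R) n).
transitivity (\int[lebesgue_rV R n]_x mine (expR (- pi * sqnorm x))%:E 1); last first.
  apply: eq_integral => x _; rewrite min_l// lee_fin -expR0 ler_expR mulNr.
  by rewrite oppr_le0 mulr_ge0 ?pi_ge0 ?sqnorm_ge0.
rewrite layer_cake; [|exact: measurable_expsq|by move=> x; rewrite lee_fin expR_ge0].
rewrite /moment -ge0_integralZl//.
apply: eq_integral => t; rewrite inE/= in_itv/= => t01.
rewrite muleC -lebesgue_eball ?rho_gt0//; congr (lebesgue_rV _ _ _).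
by apply/seteqP; split => x /=; rewrite superlevel_gauss.
Qed.

(** Two nonnegative extended reals with product 1 are both finite, so [eball_moment] carries over to
    [kappa], which is defined through [fine]. *)
Let moment_fin n : moment n \is a fin_num /\ (kappa n * fine (moment n) = 1 :> R)%R.
Proof.
have := eball_moment n; rewrite /kappa.
have : 0 <= moment n by apply: integral_ge0 => t _; exact: rhoX_ge0.
have : 0 <= lebesgue_rV R n (eball n) by exact: measure_ge0.
case: (lebesgue_rV R n (eball n)) => [v| |]//; case: (moment n) => [m| |]//.
- by move=> _ _; rewrite -EFinM => -[->].
- rewrite le_eqVlt => /predU1P[<-|v0] _; first by
    rewrite mul0e => -[] /eqP; rewrite eq_sym oner_eq0.
  by rewrite gt0_muley.
- move=> _; rewrite le_eqVlt => /predU1P[<-|v0]; first by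
    rewrite mule0 => -[] /eqP; rewrite eq_sym oner_eq0.
  by rewrite gt0_mulye.
Qed.

Lemma measurable_gauss_sqdist n (K : set 'rV[R]_n) :
  measurable_fun setT (fun x => (expR (- pi * sqdist x K))%:E).
Proof.
apply/measurable_EFinP; apply: measurableT_comp => //.
by apply: measurable_funM => //; exact: measurable_sqdist.
Qed.

Lemma wills_integral n (K : set 'rV[R]_n) (w : R) :
  K !=set0 -> compact K -> is_wills_functional K w ->
  \int[lebesgue_rV R n]_x (expR (- pi * sqdist x K))%:E = w%:E.
Proof.
move=> K0 cK [V steinerV ->].
transitivity (\int[lebesgue_rV R n]_x mine (expR (- pi * sqdist x K))%:E 1).
  apply: eq_integral => x _; rewrite min_l// lee_fin -expR0 ler_expR mulNr.
  by rewrite oppr_le0 mulr_ge0 ?pi_ge0 ?sqdist_ge0.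
rewrite layer_cake; [|exact: measurable_gauss_sqdist|by move=> x; rewrite lee_fin expR_ge0].
(* The superlevel set at height [t] is the parallel body of radius [rho t], whose volume Steiner's
   formula gives. *)
transitivity (\int[leb]_(t in `]0%R, 1%R[)
    \sum_(i < n.+1) ((kappa (n - i) * V i)%:E * (rho t ^+ (n - i))%:E)).
  apply: eq_integral => t; rewrite inE/= in_itv/= => t01.
  under eq_bigr do rewrite -EFinM.
  rewrite sumEFin -steinerV ?ltW ?rho_gt0// -sqdist_sublevel ?ltW ?rho_gt0//.
  by congr (lebesgue_rV _ _ _); apply/seteqP; split => x /=; rewrite superlevel_gauss.
(* The coefficients [V i] carry no sign hypothesis, so linearity of the integral is applied to
   integrable terms rather than to nonnegative ones. *)
have intrho k : leb.-integrable `]0%R, 1%R[ (fun t => (rho t ^+ k)%:E).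
  apply/integrableP; split => //.
  under eq_integral do rewrite gee0_abs//.
  by rewrite -ge0_fin_numE ?(moment_fin k).1// integral_ge0.
rewrite integral_sum//; last by move=> i; exact: integrableZl.
rewrite -sumEFin; apply: eq_bigr => i _; rewrite integralZl//.
have [mfin km] := moment_fin (n - i).
by rewrite -/(moment _) -(fineK mfin) -EFinM mulrAC km mul1r.
Qed.

End wills_integral.

(** * The two bounds for the Wills integral *)

Section wills_bounds.
Context {R : realType}.
Local Open Scope ereal_scope.

Lemma integral_gauss_half n (b : 'rV[R]_n) :
  \int[lebesgue_rV R n]_x (expR (- (pi / 2) * sqnorm (x + b)))%:E =
  (Num.sqrt 2 ^+ n)%:E.
Proof.
rewrite (integral_shift b (measurable_expsq _)); last by move=> x; rewrite lee_fin expR_ge0.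
have s0 : (0 < Num.sqrt 2 :> R)%R by rewrite sqrtr_gt0.
rewrite -(integral_affine 0%R s0 (measurable_expsq _)); last first.
  by move=> x; rewrite lee_fin expR_ge0.
rewrite -[RHS]mule1 -(integral_gauss (R := R) n); congr (_ * _).
apply: eq_integral => x _; rewrite addr0 sqnormZ sqr_sqrtr//.
by congr (expR _)%:E; field.
Qed.

Lemma measurable_shift n (b : 'rV[R]_n) :
  measurable_fun setT (fun x : 'rV[R]_n => x + b)%R.
Proof.
by apply: (eq_measurable_fun _ _ (measurable_affine 1 b)) => x _; rewrite scale1r.
Qed.

Lemma measurable_gauss_shift n (b : 'rV[R]_n) :
  measurable_fun setT (fun z : 'rV[R]_n => (expR (- pi * sqnorm (z + b)))%:E).
Proof. exact: (measurableT_comp (measurable_expsq (- pi)) (measurable_shift b)). Qed.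

Lemma powR_half (a : R) n : (0 <= a)%R -> (a `^ (n%:R / 2) = Num.sqrt a ^+ n)%R.
Proof. by move=> a0; rewrite mulrC powRrM powR12_sqrt// powR_mulrn// sqrtr_ge0. Qed.

(** In the upper bound, [2 ^+ n] is the Jacobian of the midpoint substitution and [Num.sqrt 2 ^+ n]
    is the mass of [exp (- pi * |x|^2 / 2)]. *)
Lemma powR_8 n : (8 `^ (n%:R / 2) = 2 ^+ n * Num.sqrt 2 ^+ n :> R)%R.
Proof.
rewrite powR_half// -exprMn; congr (_ ^+ n)%R.
have -> : (8 = 2 ^+ 2 * 2 :> R)%R by rewrite expr2; lra.
by rewrite sqrtrM ?sqr_ge0// sqrtr_sqr ger0_norm.
Qed.

Lemma convex_midpoint n (K : set 'rV[R]_n) x y :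
  convex_set K -> K x -> K y -> K (2^-1 *: (x + y))%R.
Proof.
move=> cK Kx Ky.
have half0 : (0 <= 2^-1 :> R)%R by rewrite invr_ge0.
have half1 : (2^-1 <= 1 :> R)%R by rewrite invf_le1 ?ler1n.
have := cK x y (Itv01 half0 half1); rewrite !inE => /(_ Kx Ky).
by rewrite /conv/= scalerDr; congr (K (_ + _ *: _)%R); rewrite /unstable.onem; field.
Qed.

Lemma wills_upper n (K : set 'rV[R]_n) (b : 'rV[R]_n) :
  K !=set0 -> compact K -> convex_set K ->
  \int[lebesgue_rV R n]_x (expR (- pi * sqdist x K))%:E *
  \int[lebesgue_rV R n]_(z in K) (expR (- pi * sqnorm (z + b)))%:E <=
  (2 ^+ n * Num.sqrt 2 ^+ n)%:E * lebesgue_rV R n K.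
Proof.
move=> K0 cK convK.
have mK := compact_measurable_rV cK.
pose phi (x m : 'rV[R]_n) : \bar R :=
  ((\1_K m) * expR (- (pi / 2) * sqnorm (x - b - 2 *: m)))%:E.
have phi0 x m : 0 <= phi x m.
  by rewrite lee_fin mulr_ge0 ?expR_ge0.
have mlin : measurable_fun setT
    (fun p : 'rV[R]_n * 'rV[R]_n => p.1 - b - 2 *: p.2)%R.
  apply: measurable_fun_rV => i.
  apply: (eq_measurable_fun (fun p : 'rV[R]_n * 'rV[R]_n =>
    (p.1 ord0 i : measurableTypeR R) - b ord0 i - 2 * p.2 ord0 i)%R) => [p _|].
    by rewrite !mxE.
  apply: measurable_funB.
    apply: measurable_funB => //.
    exact: (measurableT_comp (measurable_coor i) measurable_fst).
  apply: measurable_funM => //.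
  exact: (measurableT_comp (measurable_coor i) measurable_snd).
have mphi : measurable_fun setT (fun p : 'rV[R]_n * 'rV[R]_n => phi p.1 p.2).
  apply/measurable_EFinP; apply: measurable_funM.
    apply: (measurableT_comp _ measurable_snd); exact: measurable_indic.
  apply: measurableT_comp => //; apply: measurable_funM => //.
  exact: (measurableT_comp (@measurable_sqnorm R n) mlin).
have mphix x : measurable_fun setT (phi x).
  exact: (measurableT_comp mphi (measurable_pair1 x)).
have mG := measurable_gauss_shift b.
set I := \int[_]_(z in K) _.
have I0 : 0 <= I by apply: integral_ge0 => z _; rewrite lee_fin expR_ge0.
rewrite -ge0_integralZr//; last exact: measurable_gauss_sqdist.
apply: (@le_trans _ _ (\int[lebesgue_rV R n]_x
    ((2 ^+ n)%:E * \int[lebesgue_rV R n]_m phi x m))).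
  apply: ge0_le_integral => //.
  - by move=> x _; rewrite mule_ge0// lee_fin expR_ge0.
  - by apply: emeasurable_funM => //; exact: measurable_gauss_sqdist.
  - apply: measurable_funeM.
    exact: (measurable_fun_fubini_tonelli_F (m2 := lebesgue_rV R n) _ mphi).
  (* The nearest point [p] varies with [x], but the bound [phi x m] does not mention it. *)
  move=> x _; have [p Kp ->] := sqdist_attained x K0 cK.
  have h0 : (0 < 2^-1 :> R)%R by [].
  (* The substitution [m = z / 2 + p / 2]; its factor [2^-1 ^+ n] cancels [2 ^+ n]. *)
  rewrite -(integral_affine (2^-1 *: p)%R h0 (mphix x))//.
  rewrite muleA -EFinM -exprMn divff// expr1n mul1e.
  have <- : \int[lebesgue_rV R n]_(z in K) ((expR (- pi * sqnorm (x - p)))%:E *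
      (expR (- pi * sqnorm (z + b)))%:E) = (expR (- pi * sqnorm (x - p)))%:E * I.
    by apply: ge0_integralZl => //; exact: measurable_funTS.
  rewrite integral_mkcond; apply: ge0_le_integral => //.
  - by move=> z _; rewrite /patch; case: ifP => _;
      [by rewrite mule_ge0 ?lee_fin ?expR_ge0|exact: lexx].
  - by apply/(measurable_restrictT _ mK); apply: measurable_funTS; apply: measurable_funeM.
  - exact: (measurableT_comp (mphix x) (measurable_affine _ _)).
  move=> z _; rewrite /patch; case: ifPn => // /[!inE] Kz.
  rewrite /phi -scalerDr indicE mem_set; last exact: convex_midpoint.
  rewrite mul1r -EFinM -expRD lee_fin ler_expR scalerA divff// scale1r.
  (* The difference of these two vectors is [x - b - 2 m]; dropping the square of their sum leaves
     the required inequality. *)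
  have := sqnorm_parallelogram (x - p) (z + b).
  have -> : (x - p - (z + b) = x - b - (z + p))%R.
    by apply/rowP => i; rewrite !mxE; ring.
  move=> par; have := sqnorm_ge0 (x - p + (z + b)).
  have := @pi_ge0 R; nra.
rewrite ge0_integralZl//; last 2 first.
- exact: (measurable_fun_fubini_tonelli_F (m2 := lebesgue_rV R n) _ mphi).
- by move=> x _; exact: integral_ge0.
(* With the order exchanged, the integral in [x] equals [Num.sqrt 2 ^+ n] for every [m] in [K]. *)
rewrite (fubini_tonelli _ mphi)//= EFinM -muleA lee_pmul2l//.
rewrite -integral_cst//.
rewrite [leRHS]integral_mkcond le_eqVlt; apply/orP; left; apply/eqP.
apply: eq_integral => m _; rewrite /phi /patch indicE.
case: ifPn => mK'; last first.
  by rewrite integral0_eq// => x _; rewrite mul0r.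
rewrite /= -(integral_gauss_half (- b - 2 *: m)%R).
by apply: eq_integral => x _; rewrite mul1r -addrA.
Qed.

Lemma wills_lower n (K : set 'rV[R]_n) :
  K !=set0 -> compact K -> convex_set K ->
  (2 ^+ n * Num.sqrt 2 ^+ n)%:E * lebesgue_rV R n K <=
  \int[lebesgue_rV R n]_x (expR (- pi * sqdist x K))%:E *
  \int[lebesgue_rV R n]_x (expR (- pi * sqdist x K))%:E.
Proof.
move=> K0 cK convK; set W := \int[_]_x _.
have mK := compact_measurable_rV cK.
have s0 : (0 < Num.sqrt 2 :> R)%R by rewrite sqrtr_gt0.
have is0 : (0 < (Num.sqrt 2)^-1 :> R)%R by rewrite invr_gt0.
have s2 : (Num.sqrt 2 * Num.sqrt 2 = 2 :> R)%R by rewrite -expr2 sqr_sqrtr.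
(* [A] is [sqrt 2 * K]; the zero shift matches the form of the affine lemmas. *)
pose A := [set x : 'rV[R]_n | K ((Num.sqrt 2)^-1 *: x + 0)%R].
have mA : measurable A by exact: measurable_preimage_affine.
have mW := @measurable_gauss_sqdist R n K.
pose H := \int[lebesgue_rV R n]_x (expR (- pi * sqdist (Num.sqrt 2 *: x + 0)%R K))%:E.
have PL : \int[lebesgue_rV R n]_x (\1_A x)%:E *
    \int[lebesgue_rV R n]_x (expR (- pi * sqnorm x))%:E <= H * H.
  apply: prekopa_leindler.
  - by apply/measurable_EFinP; exact: measurable_indic.
  - exact: measurable_expsq.
  - exact: (measurableT_comp mW (measurable_affine _ _)).
  - by move=> x; rewrite lee_fin indicE ler0n.
  - by move=> x; rewrite lee_fin expR_ge0.
  - by move=> x; rewrite lee_fin expR_ge0.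
  - move=> x y; rewrite indicE; have [|_] := boolP (x \in A); last first.
      by rewrite mul0e mule_ge0// lee_fin expR_ge0.
    rewrite inE /A /= addr0 mul1e -EFinM -expRD lee_fin ler_expR => Ax.
    (* The point [x / sqrt 2] of [K] differs from [sqrt 2 * (x + y) / 2] by [y / sqrt 2], so twice
       the squared distance is at most [|y|^2]. *)
    have := sqdist_le (Num.sqrt 2 *: (2^-1 *: (x + y)) + 0)%R Ax.
    have -> : (Num.sqrt 2 *: (2^-1 *: (x + y)) + 0 - (Num.sqrt 2)^-1 *: x =
        (Num.sqrt 2)^-1 *: y)%R.
      have -> : ((Num.sqrt 2)^-1 = Num.sqrt 2 / 2 :> R)%R.
        have sV (s : R) : (s * s = 2 -> s != 0 -> s^-1 = s / 2)%R by move=> <- ?; field.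
        by apply: sV => //; rewrite gt_eqF.
      by apply/rowP => i; rewrite !mxE; ring.
    rewrite sqnormZ exprVn sqr_sqrtr// => dle.
    have := @pi_ge0 R; nra.
have AK : \int[lebesgue_rV R n]_x (\1_A x)%:E = (Num.sqrt 2 ^+ n)%:E * lebesgue_rV R n K.
  rewrite integral_indic// setIT -(lebesgue_preimage_affine 0%R is0 mK) muleA.
  by rewrite -EFinM -exprMn divff ?expr1n ?mul1e// gt_eqF.
have WH : W = (Num.sqrt 2 ^+ n)%:E * H by rewrite /W -(integral_affine 0%R s0 mW).
(* Since [W = sqrt 2 ^ n * H], multiplying the inequality for [H * H] by [2 ^ n] gives the claim. *)
move: PL; rewrite (integral_gauss n) mule1 AK WH => PL.
have s2n : (Num.sqrt 2 ^+ n * Num.sqrt 2 ^+ n = 2 ^+ n :> R)%R by rewrite -exprMn s2.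
by rewrite [leRHS]muleACA -EFinM s2n EFinM -muleA lee_pmul2l// lte_fin exprn_gt0.
Qed.

End wills_bounds.

(** * Gaussian measure of the dilated body *)

Section gamma_rV.
Context {R : realType}.
Local Open Scope ereal_scope.

(** Substituting [x = s *: z + y] turns [|x|^2 / 2] into [pi * |z + y / s|^2], and the Jacobian
    [s ^+ n] cancels the normalizing constant. The shift [b] of [wills_upper] is thus [y / s]. *)
Lemma gamma_dilate n (K : set 'rV[R]_n) (y : 'rV[R]_n) : measurable K ->
  let s : R := Num.sqrt (2 * pi) in
  gamma (translate y (dilate s K)) =
  \int[lebesgue_rV R n]_(z in K) (expR (- pi * sqnorm (z + s^-1 *: y)))%:E.
Proof.
move=> mK s.
have p2 : (0 < 2 * pi :> R)%R by rewrite mulr_gt0 ?pi_gt0.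
have s0 : (0 < s)%R by rewrite sqrtr_gt0.
have s2 : (s ^+ 2 = 2 * pi)%R by rewrite sqr_sqrtr// ltW.
have KE z : translate y (dilate s K) (s *: z + y)%R <-> K z.
  split=> [[_ [k Kk <-]]|Kz]; last first.
    by exists (s *: z)%R; [exists z|rewrite addrC].
  rewrite addrC => /addIr/(scalerI (_ : s != 0)%R) <-//; by rewrite gt_eqF.
pose A := translate y (dilate s K).
have mA : measurable A.
  rewrite (_ : A = [set x | K (s^-1 *: x + - (s^-1 *: y))%R]).
    exact: measurable_preimage_affine.
  have xE x : (x = s *: (s^-1 *: x - s^-1 *: y) + y)%R.
    by rewrite scalerBr !scalerA divff ?gt_eqF// !scale1r subrK.
  apply/seteqP; split => [x Ax|x /KE]; last by rewrite -xE.
  by apply/KE; rewrite -xE.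
pose f (x : 'rV[R]_n) : \bar R :=
  ((2 * pi) `^ (- (n%:R / 2)) * expR (- (enorm x ^+ 2 / 2)))%:E.
have fE x : f x = ((s ^+ n)^-1)%:E * (expR (- 2^-1 * sqnorm x))%:E.
  by rewrite /f powRN powR_half ?ltW// sqr_enorm EFinM mulNr (mulrC (sqnorm x)).
have mf : measurable_fun setT f.
  rewrite (_ : f = fun x => ((s ^+ n)^-1)%:E * (expR (- 2^-1 * sqnorm x))%:E).
    by apply: measurable_funeM; exact: measurable_expsq.
  exact/funext.
have f0 x : 0 <= f x by rewrite lee_fin mulr_ge0 ?powR_ge0 ?expR_ge0.
have mfA : measurable_fun setT (f \_ A).
  by apply/(measurable_restrictT _ mA); apply: measurable_funTS.
rewrite /gamma integral_mkcond -(integral_affine y s0 mfA); last first.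
  by move=> x; rewrite /patch; case: ifP => _; [exact: f0|exact: lexx].
rewrite [RHS]integral_mkcond -ge0_integralZl; first last.
- by rewrite lee_fin exprn_ge0// ltW.
- by move=> x _; rewrite /patch; case: ifP => _; [exact: f0|exact: lexx].
- exact: (measurableT_comp mfA (measurable_affine s y)).
- exact: measurableT.
apply: eq_integral => z _; rewrite /patch.
have -> : ((s *: z + y)%R \in A) = (z \in K).
  by apply/idP/idP => /set_mem/KE/mem_set.
case: ifPn => _; last by rewrite mule0.
rewrite -/(f _) fE -!EFinM mulrA divff ?gt_eqF ?exprn_gt0// mul1r.
have -> : (s *: z + y = s *: (z + s^-1 *: y))%R.
  by rewrite scalerDr scalerA divff ?gt_eqF// scale1r.
by rewrite sqnormZ s2; congr (expR _)%:E; field.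
Qed.

Lemma gamma_le1 n (K : set 'rV[R]_n) (y : 'rV[R]_n) : measurable K ->
  gamma (translate y (dilate (Num.sqrt (2 * pi)) K)) <= 1.
Proof.
move=> mK; rewrite gamma_dilate//.
rewrite -(integral_gauss (R := R) n)
  -(integral_shift ((Num.sqrt (2 * pi))^-1 *: y)%R); last 2 first.
- exact: measurable_expsq.
- by move=> x; rewrite lee_fin expR_ge0.
by apply: ge0_subset_integral => //; exact: measurable_gauss_shift.
Qed.

(** Balls of the topology on row vectors are coordinatewise, so a neighbourhood of an interior point
    contains a box with sides of positive length. *)
Lemma lebesgue_interior_gt0 n (K : set 'rV[R]_n) :
  measurable K -> interior K !=set0 -> 0 < lebesgue_rV R n K.
Proof.
move=> mK [x /nbhs_ballP[e /= e0 xeK]].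
pose B (i : 'I_n) : set (measurableTypeR R) :=
    `](x ord0 i - e)%R, (x ord0 i + e)%R[%classic.
have mB i : measurable (B i) by exact: measurable_itv.
have mbox := measurable_box mB.
apply: (@lt_le_trans _ _ (lebesgue_rV R n [set y | forall i, B i (y ord0 i)])).
  rewrite lebesgue_rV_box//; apply: (big_ind (fun y => 0 < y)) => [//|? ? /mule_gt0 gt0 /gt0//|i _].
  rewrite lebesgue_measure_itv/= lte_fin ifT; last by rewrite ltrBlDr -addrA ltrDl addr_gt0.
  by rewrite -EFinB lte_fin subr_gt0 ltrBlDr -addrA ltrDl addr_gt0.
apply: le_measure; rewrite ?inE// => y /= yB; apply: xeK; split => //= j i.
rewrite ord1 /ball/=; have := yB i; rewrite /B/= in_itv/= => /andP[h1 h2].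
by rewrite ltr_norml; apply/andP; split; rewrite ?ltrBlDl; lra.
Qed.

End gamma_rV.

Theorem theorem1p1 (R : realType) (n : nat) (K : set 'rV[R]_n) (w : R)
  (convK : convex_body K) (intK : interior K !=set0)
  (wK : is_wills_functional K w) :
  (sqrte ((8 `^ (n%:R / 2))%:E * lebesgue_rV R n K) <= w%:E)%E /\
  (w%:E <= (8 `^ (n%:R / 2))%:E * lebesgue_rV R n K /
           ereal_sup [set gamma (translate y (dilate (Num.sqrt (2 * pi)) K))
                     | y in [set: 'rV[R]_n]])%E.
Proof.
have [K0 cK cvK] := convK.
have mK := compact_measurable_rV cK.
have W := wills_integral K0 cK wK.
have w0 : 0 <= w.
  by rewrite -lee_fin -W; apply: integral_ge0 => x _; rewrite lee_fin expR_ge0.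
rewrite powR_8; split.
  have := wills_lower K0 cK cvK; rewrite W -lee_sqrt ?mule_ge0 ?lee_fin//.
  by rewrite -EFinM /= -expr2 sqrtr_sqr ger0_norm.
have volK := lebesgue_interior_gt0 mK intK.
set C := (_%:E * _)%E; set S := ereal_sup _.
have C0 : (0 < C)%E.
  by rewrite mule_gt0// lte_fin mulr_gt0 ?exprn_gt0 ?sqrtr_gt0.
have S0 : (0 <= S)%E.
  apply: le_trans (_ : gamma (translate 0 (dilate (Num.sqrt (2 * pi)) K)) <= _)%E.
    by rewrite gamma_dilate//; apply: integral_ge0 => x _; rewrite lee_fin expR_ge0.
  by apply: ereal_sup_ubound; exists 0.
have S1 : (S <= 1)%E by apply: ge_ereal_sup => _ [y _ <-]; exact: gamma_le1.
have gammaC y : (w%:E * gamma (translate y (dilate (Num.sqrt (2 * pi)) K)) <= C)%E.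
  by rewrite gamma_dilate// -W; exact: wills_upper.
have [s SE] : exists s : R, S = s%:E.
  by exists (fine S); rewrite fineK// ge0_fin_numE// (le_lt_trans S1)// ltry.
(* If the supremum were 0, its inverse would be [+oo], and since [C] is positive the right-hand side
   would be infinite. *)
rewrite SE in S0 *; move: S0; rewrite lee_fin le_eqVlt => /predU1P[<-|s0].
  by rewrite inve0 gt0_muley// leey.
rewrite inver gt_eqF// lee_pdivlMr//.
(* For positive [w] the bound on the supremum becomes the bound [C / w] on each Gaussian measure,
   which is [gammaC]. *)
have [->|w_neq0] := eqVneq w 0; first by rewrite mul0e ltW.
have w_gt0 : 0 < w by rewrite lt_def w_neq0.
rewrite muleC -lee_pdivlMr// -SE; apply: ge_ereal_sup => _ [y _ <-].
by rewrite lee_pdivlMr// muleC.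
Qed.
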